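(* For every $p\in(0,1)$ there exist a filtered probability space $(\Omega,\mathcal F,\mathbb P,(\mathcal F_t)_{t\ge 0})$ satisfying the usual conditions and, on it, families of continuous processes $X^{(n)}=(X^{(n)}_t)_{t\ge 0}$ and $G^{(n)}=(G^{(n)}_t)_{t\ge 0}$, $n\in\mathbb N$ (depending on $p$), such that for every $n$ the pair $(X^{(n)},G^{(n)})$ satisfies the Lenglart domination assumptions, and such that $$\frac{p^{-p}}{1-p}=\lim_{n\to\infty}\frac{\mathbb E\big[\big(\sup_{t\ge 0}X^{(n)}_t\big)^p\big]}{\mathbb E\big[\big(\sup_{t\ge 0}G^{(n)}_t\big)^p\big]}.$$ In particular, the constant $c_p=\frac{p^{-p}}{1-p}$ in Lenglart's inequality is sharp, i.e. it cannot be replaced by any smaller constant.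
   Context: A pair of real-valued processes $(X,G)$ on a filtered probability space $(\Omega,\mathcal F,\mathbb P,(\mathcal F_t)_{t\ge0})$ satisfies the Lenglart domination assumptions if: $X$ and $G$ are non-negative, adapted and right-continuous; $G$ is in addition non-decreasing and predictable (measurable with respect to the $\sigma$-algebra on $[0,\infty)\times\Omega$ generated by the left-continuous adapted processes); and $\mathbb E[X_\tau\mid\mathcal F_0]\le\mathbb E[G_\tau\mid\mathcal F_0]\le\infty$ for every bounded stopping time $\tau$ (conditional expectations of non-negative random variables take values in $[0,\infty]$). Usual conditions: the filtration is right-continuous and $\mathcal F_0$ contains all $\mathbb P$-null sets of the completed $\sigma$-algebra $\mathcal F$. Lenglart's inequality (known) with constant $c_p$ states: for every filtered probability space satisfying the usual conditions and every pair $(X,G)$ satisfying the Lenglart domination assumptions, for all $p\in(0,1)$, $\mathbb E[(\sup_{t\ge0}X_t)^p\mid\mathcal F_0]\le c_p\,\mathbb E[(\sup_{t\ge0}G_t)^p\mid\mathcal F_0]$, where $c_p=\frac{p^{-p}}{1-p}$. *)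

(* Defs.v *)
From HB Require Import structures.
From mathcomp Require Import all_boot all_order all_algebra.
From mathcomp Require Import all_classical all_reals all_analysis.
From mathcomp Require Import measurable_realfun.

Set Implicit Arguments.
Unset Strict Implicit.
Unset Printing Implicit Defensive.

Import Order.TTheory GRing.Theory Num.Theory.
Import numFieldNormedType.Exports.

Local Open Scope classical_set_scope.
Local Open Scope ring_scope.

(* Time is [0, +oo[.  Filtrations and processes are indexed by R, and only
   their values at times t >= 0 are ever constrained or used. *)

(* [f], restricted to [D], is measurable with respect to the sigma-algebra [H]
   of subsets of [D]. *)
Definition measurable_wrt (aT : Type) d (rT : measurableType d)
    (D : set aT) (H : set_system aT) (f : aT -> rT) : Prop :=
  preimage_set_system D f measurable `<=` H.

Section Filtrations.
Context {R : realType} {d : measure_display} {Omega : measurableType d}.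
Implicit Types (P : probability Omega R) (F : R -> set_system Omega).
Implicit Types (X G : R -> Omega -> R) (tau : Omega -> R).

Record filtration F : Prop := {
  filtration_sigma_algebra :
    forall t, 0 <= t -> sigma_algebra [set: Omega] (F t) ;
  filtration_measurable : forall t, 0 <= t -> F t `<=` measurable ;
  filtration_nondecreasing : forall s t, 0 <= s -> s <= t -> F s `<=` F t }.

(* [P.-negligible] sets are the subsets of measurable [P]-null sets, so the
   last field, together with [F 0 `<=` measurable], makes [P] complete. *)
Record usual_conditions P F : Prop := {
  usual_filtration : filtration F ;
  usual_right_continuous :
    forall t, 0 <= t -> F t = \bigcap_(s in `]t, +oo[) F s ;
  usual_complete : P.-negligible `<=` F 0 }.

Definition adapted F X : Prop :=
  forall t, 0 <= t -> measurable_wrt [set: Omega] (F t) (X t).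

Definition right_continuous_process X : Prop :=
  forall w t, 0 <= t -> X s w @[s --> t^'+] --> X t w.

Definition left_continuous_process X : Prop :=
  forall w t, 0 < t -> X s w @[s --> t^'-] --> X t w.

Definition continuous_process X : Prop :=
  forall w, {within `[0, +oo[, continuous (X ^~ w)}.

Definition time_space : set (R * Omega) := `[0, +oo[ `*` [set: Omega].

Definition predictable_sigma_algebra F : set_system (R * Omega) :=
  <<s time_space,
      \bigcup_(Y in [set Y | adapted F Y /\ left_continuous_process Y])
        preimage_set_system time_space (fun z => Y z.1 z.2) measurable >>.

Definition predictable F X : Prop :=
  measurable_wrt time_space (predictable_sigma_algebra F)
    (fun z : R * Omega => X z.1 z.2).

Record bounded_stopping_time F tau : Prop := {
  stopping_time_ge0 : forall w, 0 <= tau w ;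
  stopping_time_measurable :
    forall t, 0 <= t -> F t [set w | tau w <= t] ;
  stopping_time_bounded : exists K : R, forall w, tau w <= K }.

(* [Z] is a version of E[Y | H], for [0, +oo]-valued [Y] and a
   sub-sigma-algebra [H].  Versions are unique up to a [P]-null set, so that an
   almost sure inequality between conditional expectations may be stated, as
   below, for some choice of versions. *)
Record is_condexp P (H : set_system Omega) (Y Z : Omega -> \bar R) : Prop := {
  condexp_ge0 : forall w, (0 <= Z w)%E ;
  condexp_measurable : measurable_wrt [set: Omega] H Z ;
  condexp_integral : forall A, H A ->
    (\int[P]_(w in A) Z w = \int[P]_(w in A) Y w)%E }.

Record lenglart_domination P F X G : Prop := {
  dom_ge0 : forall t w, 0 <= t -> 0 <= X t w /\ 0 <= G t w ;
  dom_adapted : adapted F X /\ adapted F G ;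
  dom_right_continuous :
    right_continuous_process X /\ right_continuous_process G ;
  dom_nondecreasing :
    forall w s t, 0 <= s -> s <= t -> G s w <= G t w ;
  dom_predictable : predictable F G ;
  dom_condexp_le : forall tau, bounded_stopping_time F tau ->
    exists ZX ZG : Omega -> \bar R,
      [/\ is_condexp P (F 0) (fun w => (X (tau w) w)%:E) ZX,
          is_condexp P (F 0) (fun w => (G (tau w) w)%:E) ZG &
          {ae P, forall w, (ZX w <= ZG w)%E}] }.

Definition process_sup X (w : Omega) : \bar R :=
  ereal_sup [set (X t w)%:E | t in `[0, +oo[].

Definition process_sup_pow X (p : R) (w : Omega) : \bar R :=
  (process_sup X w `^ p)%E.

End Filtrations.

Definition lenglart_const {R : realType} (p : R) : R := p `^ (- p) / (1 - p).

Definition lenglart_inequality {R : realType} (p c : R) : Prop :=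
  forall (d : measure_display) (Omega : measurableType d)
    (P : probability Omega R) (F : R -> set_system Omega)
    (X G : R -> Omega -> R),
  usual_conditions P F -> lenglart_domination P F X G ->
  exists ZX ZG : Omega -> \bar R,
    [/\ is_condexp P (F 0) (process_sup_pow X p) ZX,
        is_condexp P (F 0) (process_sup_pow G p) ZG &
        {ae P, forall w, (ZX w <= c%:E * ZG w)%E}].

(* Main.v *)
(* A spine of biased coins leaves X = 0 and lets G grow geometrically, like r^i;
   with hazard q = 1 - r^-p the i-th coin launches X at height about r^i, the
   increments of G being exactly the compensator of these launches.  As r -> 1
   this makes the p-th moment of the launch height p^-p times that of G.  After
   its launch at a, X follows a discrete martingale that reaches r^j a with
   probability r^-j; its running maximum is nearly Pareto distributed, which
   contributes the factor 1/(1 - p).  X is interpolated linearly after each coin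
   is shown; a stopping time can exploit this head start only when X is about to
   fall, and the downward steps are made so small that the gain is absorbed by
   scaling G by a factor close to 1.  All the examples live on one discrete
   space, the time-0 sigma-algebra telling which of them is being played, and
   multiplying X by a constant at most 1 tunes the ratio exactly. *)
Require Import Defs.
From HB Require Import structures.
From mathcomp Require Import all_boot all_order all_algebra.
From mathcomp Require Import all_classical all_reals all_analysis.
From mathcomp Require Import measurable_realfun.
From mathcomp Require Import lra ring.

Set Implicit Arguments.
Unset Strict Implicit.
Unset Printing Implicit Defensive.

Import Order.TTheory GRing.Theory Num.Theory.
Import numFieldNormedType.Exports.

Local Open Scope classical_set_scope.
Local Open Scope ring_scope.

(** * Processes driven by finite coin trees *)

Section Clamp.
Context {R : realType}.
Implicit Types t : R.

Definition clamp t : R := Num.min 1 (Num.max 0 t).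

Lemma clamp_le0 t : t <= 0 -> clamp t = 0.
Proof. by move=> t0; rewrite /clamp (max_idPl t0) min_r. Qed.

Lemma clamp_ge1 t : 1 <= t -> clamp t = 1.
Proof.
by move=> t1; rewrite /clamp (@max_r _ _ 0 t) ?min_l //; exact: le_trans t1.
Qed.

Lemma clamp_itv t : 0 <= clamp t <= 1.
Proof. by rewrite /clamp ge_min lexx /= le_min ler01 le_max lexx. Qed.

Lemma clamp_nondecreasing : {homo clamp : s t / s <= t}.
Proof.
move=> s t st; rewrite /clamp le_min ge_min lexx /= ge_min; apply/orP; right.
by rewrite ge_max !le_max lexx st orbT.
Qed.

Lemma clamp_continuous : continuous (clamp : R -> R).
Proof.
move=> t; apply: (@continuous_min R R (cst 1)); first exact: cvg_cst.
by apply: (@continuous_max R R (cst 0)); [exact: cvg_cst|exact: cvg_id].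
Qed.

End Clamp.

(* [Node M g q T1 T0] at depth k: the level moves to [M] and the charge grows
   by [g] during [k, k+1]; a coin shown at time k+1 selects [T1] with
   probability [q] and [T0] otherwise. *)
Inductive tree (R : Type) : Type :=
| Leaf of R
| Node of R & R & R & tree R & tree R.

Section Tree.
Context {R : realType}.
Implicit Types (T : tree R) (s : seq bool) (t y : R).


Fixpoint proper_tree T : Prop :=
  match T with
  | Leaf M => 0 <= M
  | Node M g q T1 T0 =>
    [/\ 0 <= M, 0 <= g, 0 < q < 1, proper_tree T1 & proper_tree T0]
  end.

Fixpoint is_branch T s : bool :=
  match T, s with
  | Leaf _, [::] => true
  | Node _ _ _ T1 T0, b :: s' =>
    if b then is_branch T1 s' else is_branch T0 s'
  | _, _ => false
  end.

Fixpoint mean T (f : seq bool -> R) : R :=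
  match T with
  | Leaf _ => f [::]
  | Node _ _ q T1 T0 =>
    q * mean T1 (fun s => f (true :: s)) +
    (1 - q) * mean T0 (fun s => f (false :: s))
  end.

(** Up to time 1 the continuation still equals [M], so the last summand vanishes; after time 1 it
    replaces the finished interpolation. Written as a sum, the path is continuous by structural
    induction, with no gluing at time 1. *)
Fixpoint level y T s t : R :=
  match T with
  | Leaf M => y + (M - y) * clamp t
  | Node M _ _ T1 T0 =>
    y + (M - y) * clamp t +
    ((if head false s then level M T1 (behead s) (t - 1)
      else level M T0 (behead s) (t - 1)) - M)
  end.

Fixpoint charge T s t : R :=
  match T with
  | Leaf _ => 0
  | Node _ g _ T1 T0 =>
    g * clamp t +
    (if head false s then charge T1 (behead s) (t - 1)
     else charge T0 (behead s) (t - 1))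
  end.

Fixpoint peak y T s : R :=
  match T with
  | Leaf M => Num.max y M
  | Node M _ _ T1 T0 =>
    Num.max y (if head false s then peak M T1 (behead s)
               else peak M T0 (behead s))
  end.

Fixpoint final_charge T s : R :=
  match T with
  | Leaf _ => 0
  | Node _ g _ T1 T0 =>
    g + (if head false s then final_charge T1 (behead s) else final_charge T0 (behead s))
  end.

(* Snell envelope at the root for the reward [max (old level, new level) -
   charge]: the maximum accounts for the head start a stopping time gets from
   the continuity of the level. *)
Fixpoint snell y T : R :=
  match T with
  | Leaf M => Num.max y M
  | Node M g q T1 T0 =>
    Num.max (Num.max y M) (q * snell M T1 + (1 - q) * snell M T0 - g)
  end.

Lemma le_mean T f g : proper_tree T ->
  (forall s, is_branch T s -> f s <= g s) -> mean T f <= mean T g.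
Proof.
elim: T f g => [M|M c q T1 IH1 T0 IH0] f g /=; first by move=> _; apply.
case=> _ _ /andP[q0 q1] p1 p0 fg; apply: lerD.
  by rewrite ler_wpM2l ?(ltW q0)//; apply: IH1 => // s bs; exact: fg.
by rewrite ler_wpM2l ?subr_ge0 ?(ltW q1)//; apply: IH0 => // s bs; exact: fg.
Qed.

Lemma eq_mean T f g : (forall s, is_branch T s -> f s = g s) ->
  mean T f = mean T g.
Proof.
elim: T f g => [M|M c q T1 IH1 T0 IH0] f g /= fg; first exact: fg.
by congr (_ * _ + _ * _); [apply: IH1 => s bs | apply: IH0 => s bs]; exact: fg.
Qed.

Lemma mean_cst T y : mean T (fun=> y) = y.
Proof. by elim: T => //= M c q T1 -> T0 ->; ring. Qed.

Lemma meanD T f g : mean T (fun s => f s + g s) = mean T f + mean T g.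
Proof.
by elim: T f g => //= M c q T1 IH1 T0 IH0 f g; rewrite IH1 IH0; ring.
Qed.

Lemma meanZ T y f : mean T (fun s => y * f s) = y * mean T f.
Proof.
by elim: T f => //= M c q T1 IH1 T0 IH0 f; rewrite IH1 IH0; ring.
Qed.

Lemma mean_ge0 T f : proper_tree T ->
  (forall s, is_branch T s -> 0 <= f s) -> 0 <= mean T f.
Proof. by move=> pT f0; rewrite -(mean_cst T 0); exact: le_mean. Qed.

(** No coin is degenerate, so each branch has positive probability. This later identifies the null
    sets. *)
Lemma mean_gt0 T f s : proper_tree T -> (forall s, 0 <= f s) ->
  is_branch T s -> 0 < f s -> 0 < mean T f.
Proof.
elim: T f s => [M|M c q T1 IH1 T0 IH0] f [|b s] //=.
case=> _ _ /andP[q0 q1] p1 p0 f0; case: b => bs fs.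
  apply: ltr_pwDl; first by rewrite mulr_gt0//; exact: IH1 bs fs.
  by rewrite mulr_ge0 ?subr_ge0 ?(ltW q1)//; apply: mean_ge0.
apply: ltr_wpDl; first by rewrite mulr_ge0 ?(ltW q0)//; apply: mean_ge0.
by rewrite mulr_gt0 ?subr_gt0//; exact: IH0 bs fs.
Qed.

Lemma level_le0 y T s t : t <= 0 -> level y T s t = y.
Proof.
elim: T y s t => [M|M c q T1 IH1 T0 IH0] y s t t0 /=.
  by rewrite clamp_le0//; ring.
by rewrite clamp_le0// IH1 ?IH0; [rewrite if_same|lra..]; ring.
Qed.

Lemma charge_le0 T s t : t <= 0 -> charge T s t = 0.
Proof.
elim: T s t => [//|M c q T1 IH1 T0 IH0] s t t0 /=.
by rewrite clamp_le0// IH1 ?IH0; [rewrite if_same|lra..]; ring.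
Qed.

Let continuous_shift (f : R -> R) :
  continuous f -> continuous (fun t => f (t - 1)).
Proof.
move=> cf t; apply: (@cvg_comp _ _ _ (fun u : R => u - 1) f _ (nbhs (t - 1))).
  by apply: cvgB; [exact: cvg_id|exact: cvg_cst].
exact: cf.
Qed.

Lemma level_continuous y T s : continuous (level y T s).
Proof.
elim: T y s => [M|M c q T1 IH1 T0 IH0] y s t /=.
  apply: cvgD; first exact: cvg_cst.
  by apply: cvgM; [exact: cvg_cst|exact: clamp_continuous].
apply: cvgD.
  apply: cvgD; first exact: cvg_cst.
  by apply: cvgM; [exact: cvg_cst|exact: clamp_continuous].
apply: cvgB; last exact: cvg_cst.
by case: (head _ _); apply: continuous_shift; do ?exact: IH1; exact: IH0.
Qed.

Lemma charge_continuous T s : continuous (charge T s).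
Proof.
elim: T s => [M|M c q T1 IH1 T0 IH0] s t /=; first exact: cvg_cst.
apply: cvgD.
  by apply: cvgM; [exact: cvg_cst|exact: clamp_continuous].
by case: (head _ _); apply: continuous_shift; do ?exact: IH1; exact: IH0.
Qed.

Lemma charge_nondecreasing T s : proper_tree T ->
  {homo charge T s : t u / t <= u}.
Proof.
elim: T s => [M|M c q T1 IH1 T0 IH0] s /=; first by move=> _ t u.
move=> [_ c0 _ p1 p0] t u tu.
apply: lerD; first by rewrite ler_wpM2l// clamp_nondecreasing.
by case: ifP => _; [apply: IH1|apply: IH0] => //; lra.
Qed.

Lemma charge_ge0 T s t : proper_tree T -> 0 <= charge T s t.
Proof.
move=> pT; have [t0|t0] := leP t 0; first by rewrite charge_le0.
by rewrite -(charge_le0 T s (lexx 0)) charge_nondecreasing// ltW.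
Qed.

Lemma level_ge0 y T s t : 0 <= y -> proper_tree T -> 0 <= level y T s t.
Proof.
elim: T y s t => [M|M c q T1 IH1 T0 IH0] y s t y0 /=.
  by move=> M0; have := @clamp_itv R t; nra.
case=> M0 _ _ p1 p0; have [t1|t1] := leP t 1.
  rewrite !level_le0 ?subr_le0// if_same subrr addr0.
  by have := @clamp_itv R t; nra.
rewrite clamp_ge1 ?(ltW t1)//.
rewrite (_ : y + (M - y) * 1 + _ = if head false s then level M T1 (behead s) (t - 1)
      else level M T0 (behead s) (t - 1)); last by ring.
by case: ifP => _; [apply: IH1|apply: IH0].
Qed.

Lemma peak_ge y T s : y <= peak y T s.
Proof. by case: T => *; rewrite /= le_max lexx. Qed.

Lemma interpolation_le_max y M t : y + (M - y) * clamp t <= Num.max y M.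
Proof.
have := @clamp_itv R t; have [yM|yM] := leP y M; nra.
Qed.

Lemma level_le_peak y T s t : level y T s t <= peak y T s.
Proof.
elim: T y s t => [M|M c q T1 IH1 T0 IH0] y s t /=.
  exact: interpolation_le_max.
have [t1|t1] := leP t 1.
  rewrite !level_le0 ?subr_le0// if_same subrr addr0.
  apply: le_trans (interpolation_le_max _ _ _) _.
  rewrite ge_max le_max lexx/= le_max.
  by apply/orP; right; case: ifP => _; exact: peak_ge.
rewrite clamp_ge1 ?(ltW t1)//.
rewrite (_ : y + (M - y) * 1 + _ = if head false s then level M T1 (behead s) (t - 1)
      else level M T0 (behead s) (t - 1)); last by ring.
by rewrite le_max; apply/orP; right; case: ifP => _; [apply: IH1|apply: IH0].
Qed.

Lemma peak_attained y T s : exists2 t, 0 <= t & level y T s t = peak y T s.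
Proof.
have triv y' T' s' : exists2 t, 0 <= t & level y' T' s' t = y'.
  by exists 0 => //; exact: level_le0.
elim: T y s => [M|M c q T1 IH1 T0 IH0] y s.
  have [yM|yM] := leP y M; rewrite [peak _ _ _]/=.
    by exists 1 => //=; rewrite max_r// clamp_ge1//; ring.
  by rewrite max_l ?(ltW yM)//; exact: triv.
have [u u0 uE] : exists2 t, 0 <= t &
    (if head false s then level M T1 (behead s) t
      else level M T0 (behead s) t) = (if head false s then peak M T1 (behead s)
               else peak M T0 (behead s)).
  by case: (head _ _); [exact: IH1|exact: IH0].
rewrite [peak _ _ _]/= -uE; set v := (X in Num.max y X).
have [yv|yv] := leP y v; last by exact: triv.
exists (u + 1); first by lra.
by rewrite /= addrK clamp_ge1 ?lerDr// -/v; ring.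
Qed.

Lemma charge_le_final_charge T s t : proper_tree T -> charge T s t <= final_charge T s.
Proof.
elim: T s t => [M|M c q T1 IH1 T0 IH0] s t //= [_ c0 _ p1 p0].
apply: lerD; first by have := @clamp_itv R t; nra.
by case: ifP => _; [apply: IH1|apply: IH0].
Qed.

Lemma final_charge_attained T s : exists2 t, 0 <= t & charge T s t = final_charge T s.
Proof.
elim: T s => [M|M c q T1 IH1 T0 IH0] s; first by exists 0.
have [u u0 uE] : exists2 t, 0 <= t &
    (if head false s then charge T1 (behead s) t
      else charge T0 (behead s) t) = (if head false s then final_charge T1 (behead s)
               else final_charge T0 (behead s)).
  by case: (head _ _); [exact: IH1|exact: IH0].
exists (u + 1); first by lra.
by rewrite /= -uE addrK clamp_ge1 ?lerDr//; ring.
Qed.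

Lemma final_charge_ge0 T s : proper_tree T -> 0 <= final_charge T s.
Proof.
by move=> pT; have [t t0 <-] := final_charge_attained T s; exact: charge_ge0.
Qed.

(** * Adaptedness, stopping rules and the Snell bound *)

Lemma take_split k s s' : take k.+1 s = take k.+1 s' ->
  head false s = head false s' /\ take k (behead s) = take k (behead s').
Proof. by case: s s' => [|b s] [|b' s'] //= [-> ->]. Qed.

(** This gives adaptedness, with [k] the integer part of [t]: the coin shown at time [k + 1] cannot
    affect the path before then. *)
Lemma level_take y T k s s' t : t < k.+1%:R -> take k s = take k s' ->
  level y T s t = level y T s' t.
Proof.
elim: T y k s s' t => [//|M c q T1 IH1 T0 IH0] y [|k] s s' t tk ss' /=.
  by rewrite !level_le0 ?if_same//; move: tk; lra.
have [-> ss] := take_split ss'; have tk' : t - 1 < k.+1%:R.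
  by move: tk; rewrite -natr1; lra.
by case: ifP => _; rewrite ?(IH1 _ _ _ _ _ tk' ss) ?(IH0 _ _ _ _ _ tk' ss).
Qed.

Lemma charge_take T k s s' t : t < k.+1%:R -> take k s = take k s' ->
  charge T s t = charge T s' t.
Proof.
elim: T k s s' t => [//|M c q T1 IH1 T0 IH0] [|k] s s' t tk ss' /=.
  by rewrite !charge_le0 ?if_same//; move: tk; lra.
have [-> ss] := take_split ss'; have tk' : t - 1 < k.+1%:R.
  by move: tk; rewrite -natr1; lra.
by case: ifP => _; rewrite ?(IH1 _ _ _ _ tk' ss) ?(IH0 _ _ _ _ tk' ss).
Qed.

(** The event that stopping has occurred by the fixed time [tau s] is decided by the coins shown by
    then, so it cannot separate [s] from an [s'] sharing them. *)
Record stopping_rule T (tau : seq bool -> R) : Prop := {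
  stopping_rule_ge0 : forall s, is_branch T s -> 0 <= tau s ;
  stopping_rule_take : forall s s', is_branch T s -> is_branch T s' ->
    take (Num.trunc (tau s)) s = take (Num.trunc (tau s)) s' ->
    tau s' <= tau s }.

Lemma stopping_rule_child M g q T1 T0 b tau :
  stopping_rule (Node M g q T1 T0) tau ->
  (forall s, is_branch (if b then T1 else T0) s -> 1 <= tau (b :: s)) ->
  stopping_rule (if b then T1 else T0) (fun s => tau (b :: s) - 1).
Proof.
move=> [tau0 tauS] tau1; split=> [s bs|s s' bs bs'].
  by rewrite subr_ge0 tau1.
have st : Num.trunc (tau (b :: s)) = (Num.trunc (tau (b :: s) - 1)).+1.
  have /truncn_itv/andP[tl tu] : 0 <= tau (b :: s) - 1 by rewrite subr_ge0 tau1.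
  by apply: truncn_def; move: tl tu; rewrite -!natr1; lra.
move=> ss'; rewrite lerB//; apply: tauS; last by rewrite st /= ss'.
  by case: b bs {bs' tau1 st ss'} => /=.
by case: b bs' {bs tau1 st ss'} => /=.
Qed.

(** If some branch stops before time 1, no coin has been shown and every branch stops by time 1: the
    reward is at most a value interpolated between [y] and [M]. Otherwise every branch waits for the
    first coin, and the rule shifted by one unit is a stopping rule on each subtree. *)
Lemma stopped_le_snell y T tau : proper_tree T -> stopping_rule T tau ->
  mean T (fun s => level y T s (tau s) - charge T s (tau s)) <= snell y T.
Proof.
elim: T y tau => [M|M c q T1 IH1 T0 IH0] y tau.
  by move=> _ _; rewrite /= subr0; exact: interpolation_le_max.
move=> pT [tau0 tauS].
have [[s bs ts]|/forall2NP nt] :=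
    pselect (exists2 s, is_branch (Node M c q T1 T0) s & tau s < 1).
  have t1 s' : is_branch (Node M c q T1 T0) s' -> tau s' <= 1.
    move=> bs'; apply: le_trans (ltW ts); apply: tauS => //.
    by by rewrite (truncn0Pn _ _) ?take0// -ltNge.
  apply: (@le_trans _ _ (Num.max y M)); last by rewrite /= le_max lexx.
  rewrite -[leRHS](mean_cst (Node M c q T1 T0)); apply: le_mean => // s' bs'.
  apply: (@le_trans _ _ (y + (M - y) * clamp (tau s'))); last first.
    exact: interpolation_le_max.
  rewrite /= !level_le0 ?subr_le0 ?t1// if_same subrr addr0.
  rewrite !charge_le0 ?subr_le0 ?t1// if_same addr0 gerBl.
  by case: pT => _ c0 *; rewrite mulr_ge0//; case/andP: (@clamp_itv R (tau s')).
have t1 s' : is_branch (Node M c q T1 T0) s' -> 1 <= tau s'.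
  by move=> bs'; rewrite leNgt; apply/negP; case: (nt s').
rewrite /= le_max; apply/orP; right.
have st1 := @stopping_rule_child M c q T1 T0 true tau
  (Build_stopping_rule tau0 tauS) (fun s bs => t1 (true :: s) bs).
have st0 := @stopping_rule_child M c q T1 T0 false tau
  (Build_stopping_rule tau0 tauS) (fun s bs => t1 (false :: s) bs).
case: pT => M0 c0 /andP[q0 q1] p1 p0.
rewrite (_ : _ - c = q * (snell M T1 - c) + (1 - q) * (snell M T0 - c)); last by ring.
apply: lerD.
  rewrite ler_wpM2l ?(ltW q0)// lerBrDr.
  apply: le_trans (IH1 M _ p1 st1); rewrite -[X in _ + X](mean_cst T1) -meanD.
  apply: le_mean => // s bs; rewrite clamp_ge1 ?t1//; lra.
rewrite ler_wpM2l ?subr_ge0 ?(ltW q1)// lerBrDr.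
apply: le_trans (IH0 M _ p0 st0); rewrite -[X in _ + X](mean_cst T0) -meanD.
apply: le_mean => // s bs; rewrite clamp_ge1 ?t1//; lra.
Qed.

End Tree.

(** * Ladders and spines *)

Lemma gt1_powR_lt1 {R : realType} (r x : R) : 1 < r -> x < 0 -> r `^ x < 1.
Proof.
move=> r1 x0; rewrite /powR gt_eqF; last exact: lt_trans r1.
by rewrite expR_lt1 pmulr_llt0// ln_gt0.
Qed.

Section Ladder.
Context {R : realType} (r : R) (k : nat).
Hypothesis r1 : 1 < r.
Implicit Types (T : tree R) (s : seq bool) (a y p : R) (j : nat).

Let K : R := k.+1%:R.

(* [(rK - j)^-1] makes the level a martingale moving from [a(j+1)/K] to [r a] or
   [a j/K]. *)
Fixpoint descent j a T : tree R :=
  if j is j'.+1 then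
    Node (a * j%:R / K) 0 (r * K - j'%:R)^-1 T (descent j' a T)
  else Leaf 0.

Fixpoint ladder l a : tree R :=
  if l is l'.+1 then descent k.+1 a (ladder l' (r * a)) else Leaf a.

Let K_ge1 : 1 <= K. Proof. by rewrite ler1n. Qed.

Let descent_weight j : (j < k.+1)%N -> 1 < r * K - j%:R.
Proof.
move=> jk; have : j.+1%:R <= K by rewrite ler_nat.
by rewrite -natr1; move: K_ge1; move: r1; nra.
Qed.

Let descent_prob j : (j < k.+1)%N -> 0 < (r * K - j%:R)^-1 < 1.
Proof.
by move=> /descent_weight w; rewrite invr_gt0 invf_lt1 ?w ?andbT; lra.
Qed.

Let descent_martingale j : (j < k.+1)%N ->
  (r * K - j%:R)^-1 * r + (1 - (r * K - j%:R)^-1) * (j%:R / K) = j.+1%:R / K.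
Proof.
move=> jk; rewrite -natr1; have := descent_weight jk; have := K_ge1.
move=> K1 w; field; apply/andP; split; lra.
Qed.

Lemma proper_descent j a T : (j <= k.+1)%N -> 0 <= a -> proper_tree T ->
  proper_tree (descent j a T).
Proof.
move=> + a0 pT; elim: j => [//=|j IH] jk /=; split=> //.
- by rewrite !mulr_ge0// invr_ge0 ler0n.
- exact: descent_prob.
- exact/IH/ltnW.
Qed.

Lemma proper_ladder l a : 0 <= a -> proper_tree (ladder l a).
Proof.
elim: l a => [//|l IH] a a0; apply: proper_descent => //; apply: IH.
by rewrite mulr_ge0//; move: r1; lra.
Qed.

Lemma final_charge_ladder l a s : final_charge (ladder l a) s = 0.
Proof.
have desc j b T : (forall s, final_charge T s = 0) ->
    forall s, final_charge (descent j b T) s = 0.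
  by move=> T0; elim: j => [//|j IH] s' /=; rewrite T0 IH if_same addr0.
by elim: l a s => [//|l IH] a s; apply: desc => s'; exact: IH.
Qed.

(** For a martingale the expected reward would be the current level; the factor [v] is what the next
    rungs may add, and [a / K] is the head start of stopping just before a downward step. It is
    added only once, since a stopped path uses a single head start. *)
Lemma snell_descent j a v y T : (j <= k.+1)%N -> 0 <= a -> 1 <= v ->
  (forall y', snell y' T <= Num.max y' (v * (r * a))) ->
  snell y (descent j a T) <= Num.max y (a / K + v * (a * j%:R / K)).
Proof.
move=> + a0 v1 snT; have K1 := K_ge1; elim: j y => [|j IH] y jk.
  rewrite /= mulr0 mul0r mulr0 addr0 ge_max !le_max lexx/=.
  by rewrite divr_ge0 ?orbT//; lra.
rewrite [snell _ _]/= !ge_max le_max lexx /=; set M := a * j.+1%:R / K.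
have aK0 : 0 <= a / K by rewrite divr_ge0//; lra.
have ME : M = a / K + a * j%:R / K by rewrite /M -natr1; field; lra.
have aj0 : 0 <= a * j%:R / K by rewrite !mulr_ge0 ?invr_ge0//; lra.
apply/andP; split.
  rewrite le_max; apply/orP; right; have M0 : 0 <= M by rewrite ME addr_ge0.
  by apply: (le_trans (ler_peMl M0 v1)); rewrite lerDr.
rewrite le_max; apply/orP; right; rewrite subr0.
have /andP[q0 q1] := descent_prob jk; have := descent_martingale jk.
set q := (_ - _)^-1 in q0 q1 *; move=> mart.
have jK : j.+1%:R <= K by rewrite ler_nat.
have Ma : M <= a by rewrite /M ler_pdivrMr ?ler_wpM2l//; lra.
have s1 : snell M T <= v * (r * a).
  apply: le_trans (snT M) _; rewrite ge_max lexx andbT.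
  by apply: le_trans Ma _; rewrite mulrA ler_peMl// mulr_ege1// ltW.
(* Stopping before the fall yields [M], one step above [a * j / K]; the summand [a / K] absorbs this
   because [1 <= v]. *)
have s0 : snell M (descent j a T) <= a / K + v * (a * j%:R / K).
  by apply: le_trans (IH M (ltnW jk)) _; rewrite ge_max lexx andbT ME lerD2l ler_peMl.
have ME' : M = a * (q * r + (1 - q) * (j%:R / K)) by rewrite mart /M mulrA.
apply: (@le_trans _ _ (q * (v * (r * a)) + (1 - q) * (a / K + v * (a * j%:R / K)))).
  by apply: lerD; rewrite ler_wpM2l ?subr_ge0 ?(ltW q0) ?(ltW q1).
rewrite ME'.
rewrite (_ : q * _ + _ = (1 - q) * (a / K) + v * (a * (q * r + (1 - q) * (j%:R / K)))).
  by rewrite lerD2r ler_piMl// gerBl ltW.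
by ring.
Qed.

(** A rung at height r^i a adds a head start r^i a / K but is reached with probability r^-i, hence
    costs [a / K] on average. With [l] fixed the total factor tends to 1 as [k] grows. *)
Lemma snell_ladder l a y : 0 <= a ->
  snell y (ladder l a) <= Num.max y ((1 + l%:R / K) * a).
Proof.
have K1 := K_ge1.
elim: l a y => [|l IH] a y a0; first by rewrite /= mul0r addr0 mul1r.
have v1 : 1 <= 1 + l%:R / K by rewrite lerDl divr_ge0//; lra.
have ra0 : 0 <= r * a by move: r1; nra.
have := @snell_descent k.+1 a _ y _ (leqnn _) a0 v1 (fun y' => IH (r * a) y' ra0).
congr (_ <= Num.max _ _); rewrite -/K -natr1; field; lra.
Qed.

(** By the martingale property the descent from [a * j / K] reaches [r * a] before 0 with
    probability [j / (K * r)]. The maximum with [a] records the height attained before the descent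
    came down to step [j]. *)
Lemma mean_peak_descent j a y w p T : (j <= k.+1)%N -> 0 <= a -> 0 < p ->
  proper_tree T ->
  (forall y', w <= mean T (fun s => peak y' T s `^ p)) ->
  (1 - j%:R / K / r) * a `^ p + j%:R / K / r * w <=
  mean (descent j a T) (fun s => Num.max a (peak y (descent j a T) s) `^ p).
Proof.
move=> + a0 p0 pT wT; have K1 := K_ge1; elim: j y => [|j IH] y jk.
  rewrite /= !mul0r subr0 mul1r addr0; apply: ge0_ler_powR; rewrite ?nnegrE ?(ltW p0)//.
    by rewrite le_max a0.
  by rewrite le_max lexx.
have pd := proper_descent (ltnW jk) a0 pT.
have /andP[q0 q1] := descent_prob jk; have := descent_martingale jk.
rewrite [descent _ _ _]/= [mean _ _]/=.
set q := (_ - _)^-1 in q0 q1 *; set M := a * _ / K; move=> mart.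
apply: (@le_trans _ _ (q * w + (1 - q) *
   ((1 - j%:R / K / r) * a `^ p + j%:R / K / r * w))).
  rewrite -mart le_eqVlt; apply/orP; left; apply/eqP.
  by field; apply/andP; split; move: r1; lra.
apply: lerD.
  rewrite ler_wpM2l ?(ltW q0)//; apply: le_trans (wT M) _.
  apply: le_mean => // s _ /=; apply: ge0_ler_powR; rewrite ?nnegrE ?(ltW p0)//.
  - apply: le_trans (peak_ge _ _ _); rewrite /M !mulr_ge0 ?invr_ge0//; lra.
  - by rewrite le_max a0.
  - by rewrite !le_max lexx !orbT.
rewrite ler_wpM2l ?subr_ge0 ?(ltW q1)//; apply: le_trans (IH M (ltnW jk)) _.
apply: le_mean => // s _ /=; apply: ge0_ler_powR; rewrite ?nnegrE ?(ltW p0)//.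
- by rewrite le_max a0.
- by rewrite le_max a0.
- by rewrite ge_max !le_max !lexx !orbT.
Qed.

(** For i < l, exactly i rungs are climbed with probability (1 - r^-1) r^-i, and the peak is then at
    least r^i a; summing gives a geometric series of ratio r^(p - 1). Runs that climb all [l] rungs
    are discarded. *)
Lemma mean_peak_ladder l a y p : 0 <= a -> 0 < p < 1 ->
  (1 - r^-1) * (1 - (r `^ (p - 1)) ^+ l) / (1 - r `^ (p - 1)) * a `^ p <=
  mean (ladder l a) (fun s => peak y (ladder l a) s `^ p).
Proof.
move=> a0 /andP[p0 p1]; have rp : 0 < r by move: r1; lra.
set x := r `^ (p - 1).
have x1 : x < 1 by apply: gt1_powR_lt1 => //; lra.
have xE : x = r `^ p / r.
  by rewrite /x powRB ?powRr1 ?(ltW rp)// (gt_eqF rp) implybT.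
elim: l a y a0 => [|l IH] a y a0.
  rewrite expr0 subrr mulr0 !mul0r; apply: mean_ge0; first exact: proper_ladder.
  by move=> s _; exact: powR_ge0.
have ra0 : 0 <= r * a by rewrite mulr_ge0// ltW.
have pl := proper_ladder l ra0.
have := @mean_peak_descent k.+1 a y _ p _ (leqnn _) a0 p0 pl (fun y' => IH (r * a) y' ra0).
rewrite -/(ladder l.+1 a).
have pE s : Num.max a (peak y (ladder l.+1 a) s) = peak y (ladder l.+1 a) s.
  apply/max_idPr; rewrite /= le_max; apply/orP; right.
  have -> : a * k.+1%:R / K = a by rewrite -/K mulfK// gt_eqF// ltr0n.
  by case: ifP => _; exact: peak_ge.
under [X in mean _ X]eq_fun do rewrite pE.
apply: le_trans; rewrite le_eqVlt; apply/orP; left; apply/eqP.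
rewrite powRM ?(ltW rp)// -/K exprS xE.
have x1' : 1 - r `^ p / r != 0 by rewrite -xE subr_eq0 gt_eqF.
have K1 := K_ge1.
rewrite !divff ?gt_eqF ?ltr0n//.
set z := (_ / r) ^+ l; field.
rewrite (gt_eqF rp)/=; move: x1'; apply: contra; rewrite subr_eq0 => /eqP <-.
by rewrite divff ?subrr// gt_eqF.
Qed.

End Ladder.

Section Spine.
Context {R : realType} (r p v : R) (J : R -> tree R).
Implicit Types (h y a : R) (n : nat).
Hypotheses (r1 : 1 < r) (p01 : 0 < p < 1) (v0 : 0 < v).
Hypothesis proper_J : forall h, 0 <= h -> proper_tree (J h).

Let q := 1 - r `^ (- p).

(* [J h] is entered at hazard [q] when the charge has grown like [h]; then
   [P(n jumps not yet happened) h^p] stays constant because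
   [(1 - q) r^p = 1]. *)
Fixpoint spine n h : tree R :=
  if n is n'.+1 then Node 0 (q * (v * h)) q (J h) (spine n' (r * h))
  else Leaf 0.

Let p0 : 0 < p. Proof. by case/andP: p01. Qed.
Let p1 : p < 1. Proof. by case/andP: p01. Qed.

Let q_itv : 0 < q < 1.
Proof.
have r0 : 0 < r := lt_trans ltr01 r1.
rewrite subr_gt0 gt1_powR_lt1 ?oppr_lt0//=.
by rewrite ltrBlDr ltrDl powR_gt0.
Qed.

Let q_powR : (1 - q) * r `^ p = 1.
Proof.
have r0 : 0 < r := lt_trans ltr01 r1.
by rewrite /q opprB addrC subrK -powRD ?addNr ?powRr0// (gt_eqF r0) implybT.
Qed.

Lemma proper_spine n h : 0 <= h -> proper_tree (spine n h).
Proof.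
have /andP[q0 q1] := q_itv.
elim: n h => [//=|n IH] h h0 /=; split=> //; first by rewrite !mulr_ge0// ltW.
  exact: proper_J.
by apply: IH; rewrite mulr_ge0// ltW// (lt_trans ltr01 r1).
Qed.

(** The charge pays in advance for the launch: [q * (v * h)] is its probability times the bound on
    the Snell value of [J h]. *)
Lemma snell_spine n h : 0 <= h ->
  (forall h, 0 <= h -> snell 0 (J h) <= Num.max 0 (v * h)) ->
  snell 0 (spine n h) <= 0.
Proof.
move=> + sJ; have /andP[q0 q1] := q_itv.
elim: n h => [|n IH] h h0 /=; first by rewrite maxxx.
rewrite maxxx ge_max lexx /= subr_le0.
have vh : 0 <= v * h by rewrite mulr_ge0// ltW.
have := sJ _ h0; rewrite max_r// => sh.
have := IH (r * h); rewrite mulr_ge0; [move=> /(_ isT)|exact: ltW (lt_trans ltr01 r1)|exact: h0].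
by move=> sn; nra.
Qed.

(** Every coin contributes the same amount: survival costs a factor 1 - q, the height gains r^p, and
    their product is 1. The bound thus grows linearly in [n]. *)
Lemma mean_peak_spine n h c : 0 <= h ->
  (forall h, 0 <= h -> c * h `^ p <= mean (J h) (fun s => peak 0 (J h) s `^ p)) ->
  n%:R * (q * c * h `^ p) <=
  mean (spine n h) (fun s => peak 0 (spine n h) s `^ p).
Proof.
move=> + cJ; have /andP[q0 q1] := q_itv.
have r0 : 0 <= r := ltW (lt_trans ltr01 r1).
elim: n h => [|n IH] h h0; first by rewrite mul0r; exact: powR_ge0.
have rh0 : 0 <= r * h by rewrite mulr_ge0.
have mx0 T s : Num.max 0 (peak 0 T s) = peak 0 T s :> R.
  exact/max_idPr/peak_ge.
rewrite /=; under [X in q * mean _ X]eq_fun do rewrite mx0.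
under [X in (1 - q) * mean _ X]eq_fun do rewrite mx0.
have := IH _ rh0; have := cJ _ h0; rewrite (powRM p r0 h0) => c1 c2.
apply: (@le_trans _ _ (q * (c * h `^ p) +
    (1 - q) * (n%:R * (q * c * (r `^ p * h `^ p))))).
  rewrite -natr1 (_ : (1 - q) * _ = ((1 - q) * r `^ p) * (n%:R * (q * c * h `^ p))).
    rewrite q_powR le_eqVlt; apply/orP; left; apply/eqP; ring.
  by ring.
apply: lerD; first by rewrite ler_wpM2l// ltW.
by rewrite ler_wpM2l// subr_ge0 ltW.
Qed.

(** Here [a] is the charge collected so far. The choice of [c] makes [c * h] grow by exactly
    [q * (v * h)] from one coin to the next, so that [a <= c * h] propagates along the spine. The
    summand 1 accounts for the runs that never launch. *)
Lemma mean_final_charge_spine n h a c : 0 <= h -> 0 <= a <= c * h ->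
  c * (r - 1) = q * v -> (forall h s, final_charge (J h) s = 0) ->
  mean (spine n h) (fun s => (a + final_charge (spine n h) s) `^ p) <=
  (1 + n%:R * (q * r `^ p)) * (c * h) `^ p.
Proof.
move=> + + cE tJ; have /andP[q0 q1] := q_itv.
have r0 : 0 <= r := ltW (lt_trans ltr01 r1).
have c0 : 0 <= c.
  have : 0 < c * (r - 1) by rewrite cE mulr_gt0.
  by rewrite pmulr_lgt0 ?subr_gt0// => /ltW.
elim: n h a => [|n IH] h a h0 /andP[a0 ah].
  rewrite /= mul0r !addr0 mul1r; apply: ge0_ler_powR; rewrite ?nnegrE ?(ltW p0)//.
  by rewrite mulr_ge0.
have rh0 : 0 <= r * h by rewrite mulr_ge0.
rewrite /=; under [X in q * mean _ X]eq_fun do rewrite tJ addr0.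
rewrite mean_cst; under [X in (1 - q) * mean _ X]eq_fun do rewrite addrA.
have a' : 0 <= a + q * (v * h) <= c * (r * h).
  have vh : 0 <= q * (v * h) by rewrite !mulr_ge0// ltW.
  rewrite addr_ge0//= (_ : c * (r * h) = c * h + c * (r - 1) * h); last by ring.
  by rewrite cE -!mulrA lerD2r.
have := IH _ _ rh0 a'; have := ge0_ler_powR (ltW p0) _ _ (proj2 (andP a')).
rewrite !nnegrE (proj1 (andP a')) mulr_ge0// => /(_ isT isT).
rewrite (_ : c * (r * h) = r * (c * h)); last by ring.
rewrite (powRM p r0 (mulr_ge0 c0 h0)) => t1 t2.
apply: (@le_trans _ _ (q * (r `^ p * (c * h) `^ p) +
   (1 - q) * ((1 + n%:R * (q * r `^ p)) * (r `^ p * (c * h) `^ p)))).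
  apply: lerD; first by rewrite ler_wpM2l// ltW.
  by rewrite ler_wpM2l// subr_ge0 ltW.
rewrite (_ : (1 - q) * _ = (1 - q) * r `^ p * ((1 + n%:R * (q * r `^ p)) * (c * h) `^ p)); last by ring.
by rewrite q_powR -natr1 le_eqVlt; apply/orP; left; apply/eqP; ring.
Qed.

Lemma mean_final_charge_spine_gt0 n h : 0 < h ->
  0 < mean (spine n.+1 h) (fun s => final_charge (spine n.+1 h) s `^ p).
Proof.
move=> h0; have /andP[q0 q1] := q_itv.
have vh0 : 0 < q * (v * h) by rewrite !mulr_gt0.
apply: (@lt_le_trans _ _ ((q * (v * h)) `^ p)); first exact: powR_gt0.
have ps := proper_spine n.+1 (ltW h0).
rewrite -[leLHS](mean_cst (spine n.+1 h)); apply: le_mean => // s _.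
have tg := final_charge_ge0 s ps.
apply: ge0_ler_powR; rewrite ?nnegrE ?(ltW p0) ?(ltW vh0)//=.
rewrite lerDl; case: ifP => _; apply: final_charge_ge0; first exact/proper_J/ltW.
by apply: proper_spine; rewrite mulr_ge0// ltW// (lt_trans ltr01 r1).
Qed.

End Spine.

(** * Choice of the parameters of a nearly extremal tree *)

Section Extremal.
Context {R : realType}.
Implicit Types c p r theta : R.

(** Tangent at r = 1 of the convex function r^-s. It controls, to first order in [r - 1], both the
    hazard and the ratio of the geometric series of the ladder. *)
Lemma powRN_tangent r (s : R) : 0 < r -> 0 <= s -> 1 - s * (r - 1) <= r `^ (- s).
Proof.
move=> r0 s0; have lnr : ln r <= r - 1.
  by rewrite -[in leLHS](subrK 1 r) addrC; apply: le_ln1Dx; lra.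
rewrite /powR gt_eqF//; apply: le_trans (expR_ge1Dx _).
by rewrite lerD2l mulNr lerN2 ler_wpM2l.
Qed.

(** Five factors [theta] are the total loss incurred by the construction below. *)
Lemma exists_expr5_ge c c' : 0 <= c < c' ->
  exists2 theta, 0 < theta < 1 & c <= c' * theta ^+ 5.
Proof.
move=> /andP[c0 cc']; have c'0 : 0 < c' by apply: le_lt_trans cc'.
(* Bernoulli's inequality gives (1 - e)^5 >= 1 - 5 e = c / c'. *)
set e := (1 - c / c') / 5.
have cc1 : c / c' < 1 by rewrite ltr_pdivrMr ?mul1r.
have cc0 : 0 <= c / c' by rewrite divr_ge0 ?(ltW c'0).
have cE : c = c' * (1 - 5 * e) by rewrite /e; field; rewrite gt_eqF.
have e0 : 0 < e by rewrite /e; lra.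
have e1 : e <= 1 / 5 by rewrite /e; lra.
exists (1 - e); first by apply/andP; split; lra.
rewrite {1}cE ler_wpM2l ?(ltW c'0)//.
have b n : 1 - n%:R * e <= (1 - e) ^+ n.
  elim: n => [|n IH]; first by rewrite mul0r subr0 expr0.
  have n0 : 0 <= n%:R :> R by rewrite ler0n.
  rewrite exprS -natr1; nra.
exact: b.
Qed.

(** The parameters are chosen in this order: [r] close to 1; the number [l] of rungs, so that
    truncating the geometric series costs little; [k] so large that the head starts of [l] rungs
    inflate the charge by at most a factor [r]; finally the length of the spine. *)
Lemma extremal_tree p c : 0 < p < 1 -> 0 <= c < lenglart_const p ->
  exists T : tree R,
  [/\ proper_tree T, snell 0 T <= 0,
      0 < mean T (fun s => final_charge T s `^ p) &
      c * mean T (fun s => final_charge T s `^ p) <=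
      mean T (fun s => peak 0 T s `^ p)].
Proof.
move=> /[dup] p01 /andP[p0 p1] /[dup] /andP[c0 _] /exists_expr5_ge[th /andP[th0 th1] cth].
pose r := th^-1.
have r0 : 0 < r by rewrite invr_gt0.
have r1 : 1 < r by rewrite invf_gt1.
have rth : th * r = 1 by rewrite divff// gt_eqF.
pose x := r `^ (p - 1).
have x0 : 0 <= x by exact: powR_ge0.
have x1 : x < 1 by apply: gt1_powR_lt1 => //; lra.
have [l xl] : exists l, x ^+ l <= 1 - th.
  have /cvgrPdist_le/(_ (1 - th)) : x ^+ n @[n --> \oo] --> 0.
    by apply: cvg_expr; rewrite ger0_norm.
  rewrite subr_gt0 => /(_ th1)[l _ /(_ l (leqnn l))]/=.
  by rewrite sub0r normrN ger0_norm ?exprn_ge0// => xl; exists l.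
pose q := 1 - r `^ (- p).
have q0 : 0 < q by rewrite subr_gt0 gt1_powR_lt1// oppr_lt0.
have [k kl] : exists k : nat, l%:R / k.+1%:R <= r - 1.
  exists (Num.trunc (l%:R / (r - 1))).
  rewrite ler_pdivrMr ?ltr0n// mulrC -ler_pdivrMr ?subr_gt0//.
  by apply/ltW/truncnS_gt.
(* The summand 1 in the moment of the charge has to fit into the fraction [1 - th] of the term
   linear in the length of the spine. *)
have [n nq] : exists n : nat, th ^+ 2 <= n.+1%:R * (q * (1 - th)).
  exists (Num.trunc (th ^+ 2 / (q * (1 - th)))).
  have qth : 0 < q * (1 - th) by rewrite mulr_gt0// subr_gt0.
  rewrite -ler_pdivrMr//.
  by apply/ltW/truncnS_gt.
pose v : R := 1 + l%:R / k.+1%:R.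
have v1 : 1 <= v by rewrite lerDl divr_ge0.
have v0 : 0 < v by lra.
have vr : v <= r by rewrite -lerBrDl.
pose J h := ladder r k l h.
have pJ h : 0 <= h -> proper_tree (J h) by exact: proper_ladder.
exists (spine r p v J n.+1 1); split.
- exact: proper_spine.
- by apply: snell_spine => // h h0; exact: snell_ladder.
- exact: mean_final_charge_spine_gt0.
pose kap := (1 - r^-1) * (1 - x ^+ l) / (1 - x).
have := @mean_peak_spine R r p v J r1 p01 n.+1 1 kap ler01
  (fun h h0 => mean_peak_ladder k r1 l 0 h0 p01).
rewrite powR1 mulr1; apply: le_trans.
have C0 : 0 <= q * v / (r - 1) * 1 by rewrite mulr1 divr_ge0 ?mulr_ge0//; lra.
have := @mean_final_charge_spine R r p v J r1 p01 v0 n.+1 1 0 (q * v / (r - 1)) ler01.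
rewrite lexx C0 divfK ?subr_eq0 ?gt_eqF// => /(_ isT erefl (final_charge_ladder _ _ _)).
under eq_fun do rewrite add0r.
rewrite -/q => /(ler_wpM2l c0)/le_trans; apply.
(* This bound and the next are sharp to first order as [r] tends to 1; they produce the p^p and the
   1 - p of the constant. *)
have qp : q <= p * (r - 1) by have := powRN_tangent r0 (ltW p0); rewrite -/q /q; lra.
have xp : 1 - x <= (1 - p) * (r - 1).
  have := @powRN_tangent r (1 - p) r0; rewrite opprB -/x subr_ge0 => /(_ (ltW p1)); lra.
have rp : r `^ p <= r by apply: ler1_powR; exact: ltW.
have CE : (q * v / (r - 1) * 1) `^ p <= p `^ p * r.
  apply: (@le_trans _ _ ((p * v) `^ p)).
    apply: ge0_ler_powR; rewrite ?nnegrE ?(ltW p0)//; first by rewrite mulr_ge0 ?ltW.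
    by rewrite mulr1 mulrAC ler_wpM2r ?(ltW v0)// ler_pdivrMr// subr_gt0.
  rewrite powRM ?(ltW p0) ?(ltW v0)// ler_wpM2l ?powR_ge0//.
  by apply: le_trans vr; apply: ler1_powR => //; exact: ltW.
(* Since 1 - r^-1 = th (r - 1) and the truncation 1 - x^l is at least [th], two of the five factors
   are spent here. *)
have kapE : th ^+ 2 / (1 - p) <= kap.
  rewrite /kap ler_pdivlMr ?subr_gt0// -/r.
  apply: (@le_trans _ _ (th ^+ 2 / (1 - p) * ((1 - p) * (r - 1)))).
    by rewrite ler_wpM2l// divr_ge0 ?exprn_ge0 ?ltW ?subr_gt0.
  have -> : th ^+ 2 / (1 - p) * ((1 - p) * (r - 1)) = (1 - th) * th.
    rewrite mulrA divfK ?gt_eqF ?subr_gt0//.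
    have -> : th ^+ 2 * (r - 1) = th * (th * r) - th * th by ring.
    by rewrite rth; ring.
  by rewrite /r invrK ler_wpM2l; lra.
have Nq0 : 0 < n.+1%:R * q by rewrite mulr_gt0 ?ltr0n.
set N : R := n.+1%:R in Nq0 nq *.
apply: (@le_trans _ _ (p `^ (- p) / (1 - p) * th ^+ 5 * ((1 + N * (q * r)) * (p `^ p * r)))).
  apply: (@le_trans _ _ (c * ((1 + N * (q * r)) * (p `^ p * r)))).
    rewrite ler_wpM2l// ler_pM ?powR_ge0//.
      by rewrite addr_ge0// !mulr_ge0 ?powR_ge0 ?ltW// ltr0n.
    by rewrite lerD2l ler_wpM2l ?ler0n// ler_wpM2l ?(ltW q0).
  rewrite ler_wpM2r// !mulr_ge0 ?powR_ge0 ?(ltW r0)//.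
  by rewrite addr_ge0// !mulr_ge0 ?ltW// ltr0n.
apply: (@le_trans _ _ (N * (q * (th ^+ 2 / (1 - p))))); last first.
  by rewrite ler_wpM2l ?ler0n// ler_wpM2l ?(ltW q0).
have pp : p `^ (- p) * p `^ p = 1.
  by rewrite -powRD ?addNr ?powRr0// (gt_eqF p0) implybT.
set u := (1 - p)^-1; set P := p `^ (- p); set Q := p `^ p.
(* Of the other three factors, two cancel the factors [r] coming from the charge and one makes room
   for the summand 1. *)
have -> : P * u * th ^+ 5 * ((1 + N * (q * r)) * (Q * r)) =
    (P * Q) * (th * r) * (th ^+ 2 * u) * (th ^+ 2 + th * (th * r) * (N * q)).
  by ring.
rewrite {}/P {}/Q pp rth !mul1r mulr1.
have -> : N * (q * (th ^+ 2 * u)) = th ^+ 2 * u * (N * q) by ring.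
rewrite ler_wpM2l//; first by rewrite divr_ge0 ?exprn_ge0 ?ltW ?subr_gt0.
by move: nq; rewrite mulrA mulrBr mulr1; lra.
Qed.

End Extremal.

(** * A probability space carrying a sequence of trees *)

(** The number of the tree being played, with its coins. All subsets are events, so the information
    structure lies in the filtration alone. *)
Definition runs : Type := (nat * seq bool)%type.

HB.instance Definition _ := Choice.on runs.
HB.instance Definition _ := isPointed.Build runs (0%N, [::]).
HB.instance Definition _ := @isMeasurable.Build default_measure_display
  runs discrete_measurable discrete_measurable0
  discrete_measurableC discrete_measurableU.

Lemma measurable_fun_runs d (T : sigmaRingType d) (D : set runs)
  (f : runs -> T) : measurable_fun D f.
Proof. by move=> _ Y _. Qed.

Section TreeLaw.
Context {R : realType}.
Implicit Types (T : tree R) (e : seq bool -> runs).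

(** The map [e] carries the coins already shown. The absolute values make the weights non-negative
    for any tree and change nothing on proper ones. *)
Fixpoint tree_law T e : {measure set runs -> \bar R} :=
  match T with
  | Leaf _ => \d_(e [::])
  | Node _ _ q T1 T0 => measure_add
      (mscale `|q|%:nng (tree_law T1 (fun s => e (true :: s))))
      (mscale `|1 - q|%:nng (tree_law T0 (fun s => e (false :: s))))
  end.

Lemma integral_tree_law T e (f : runs -> R) : proper_tree T ->
  (forall w, 0 <= f w) ->
  (\int[tree_law T e]_w (f w)%:E = (mean T (fun s => f (e s)))%:E)%E.
Proof.
move=> + f0; elim: T e => [M|M c q T1 IH1 T0 IH0] e /=.
  by move=> _; rewrite integral_dirac ?diracT ?mul1e.
move=> [_ _ /andP[q0 q1] p1 p0].
have mf : measurable_fun setT (EFin \o f) by exact: measurable_fun_runs.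
have f0' w : [set: runs] w -> (0 <= (EFin \o f) w)%E by rewrite lee_fin.
rewrite ge0_integral_measure_sum// 2!big_ord_recl big_ord0 adde0 /=.
rewrite !ge0_integral_mscale// IH1// IH0//=.
by rewrite !ger0_norm ?subr_ge0 ?ltW// -!EFinM -EFinD.
Qed.

End TreeLaw.

Section Mixture.
Context {R : realType} (tr : nat -> tree R).
Hypothesis pT : forall n, proper_tree (tr n).
Implicit Types (n : nat) (s : seq bool) (w : runs) (t : R).

Definition slot_weight n : R := (2 ^+ n.+1)^-1.

Lemma slot_weight_gt0 n : 0 < slot_weight n.
Proof. by rewrite invr_gt0 exprn_gt0. Qed.

Lemma slot_weight_ge0 n : 0 <= slot_weight n.
Proof. exact/ltW/slot_weight_gt0. Qed.

(** Properness is an argument so that the probability structure, whose total mass 1 relies on it,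
    can be attached to [mixture pT]. *)
Definition mixture of (forall n, proper_tree (tr n)) : set runs -> \bar R :=
  mseries (fun n => mscale `|slot_weight n|%:nng (tree_law (tr n) (pair n))) 0.

HB.instance Definition _ := Measure.on (mixture pT).

Lemma integral_mixture (f : runs -> R) : (forall w, 0 <= f w) ->
  (\int[mixture pT]_w (f w)%:E =
   \sum_(n <oo) (slot_weight n * mean (tr n) (fun s => f (n, s)))%:E)%E.
Proof.
move=> f0.
have mf : measurable_fun setT (EFin \o f) by exact: measurable_fun_runs.
have f0' w : [set: runs] w -> (0 <= (EFin \o f) w)%E by rewrite lee_fin.
rewrite ge0_integral_measure_series//; apply: eq_eseriesr => n _.
by rewrite ge0_integral_mscale// integral_tree_law//= ger0_norm// ltW// slot_weight_gt0.
Qed.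

Let mixture_setT : mixture pT setT = 1%E.
Proof.
have <- : (\int[mixture pT]_w (cst 1 w)%:E = mixture pT setT)%E.
  exact: etrans (integral_cst (mixture pT) measurableT 1%E) (mul1e _).
rewrite integral_mixture//.
under eq_eseriesr do rewrite mean_cst mulr1.
have := @cvg_geometric_eseries_half R 1 0%N; rewrite expr0 divr1 => /cvg_lim <-//.
congr (limn _); apply/funext => n; apply: eq_bigr => i _.
by rewrite /slot_weight mul1r addn1 natrX.
Qed.

HB.instance Definition _ := Measure_isProbability.Build _ _ _ (mixture pT) mixture_setT.

End Mixture.

Lemma process_sup_attained {R : realType} d (Omega : measurableType d)
  (Y : R -> Omega -> R) w m :
  (forall t, 0 <= t -> Y t w <= m) -> (exists2 t, 0 <= t & Y t w = m) ->
  process_sup Y w = m%:E.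
Proof.
move=> Ym [t t0 tm]; apply/eqP; rewrite eq_le; apply/andP; split.
  apply/ereal_supP => _ [u /= + <-]; rewrite in_itv/= andbT lee_fin.
  exact: Ym.
by apply: ereal_sup_ubound; exists t; rewrite ?tm//= in_itv/= t0.
Qed.

(** * The filtration generated by the coins and the processes on it *)

Section History.
Context {R : realType} (tr : nat -> tree R).
Hypothesis pT : forall n, proper_tree (tr n).
Implicit Types (n : nat) (s : seq bool) (w : runs) (t : R).

(* Only runs along branches are compared, which makes every null set an event. *)
Definition history t : set_system runs :=
  [set A | forall n s s', is_branch (tr n) s -> is_branch (tr n) s' ->
    take (Num.trunc t) s = take (Num.trunc t) s' -> A (n, s) -> A (n, s')].

Lemma history_trunc t u : (Num.trunc t <= Num.trunc u)%N ->
  history t `<=` history u.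
Proof.
move=> tu A At n s s' bs bs' ss'; apply: At => //.
by rewrite -(take_takel s tu) -(take_takel s' tu) ss'.
Qed.

Lemma measurable_wrt_history d (T : measurableType d) t (Y : runs -> T) :
  (forall n s s', is_branch (tr n) s -> is_branch (tr n) s' ->
    take (Num.trunc t) s = take (Num.trunc t) s' -> Y (n, s) = Y (n, s')) ->
  measurable_wrt setT (history t) Y.
Proof.
move=> YE _ [B mB <-] n s s' bs bs' ss' [_ /= YB]; split=> //=.
by rewrite -(YE _ _ _ bs bs' ss').
Qed.

Lemma history_filtration : filtration history.
Proof.
split=> [t _|t _ A _ //|u t u0 ut]; last exact: history_trunc (le_truncn ut).
split=> [? //|A At n s s' bs bs' ss' [_ As]|A At n s s' bs bs' ss' [i _ Ais]].
  by split=> // As'; apply: As; exact: At As'.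
by exists i => //; exact: At Ais.
Qed.

Lemma mixture_gt0 n s (A : set runs) : is_branch (tr n) s -> A (n, s) ->
  (0 < mixture pT A)%E.
Proof.
move=> bs As.
have -> : mixture pT A = (\int[mixture pT]_w (\1_A w)%:E)%E.
  by rewrite integral_indic// setIT.
have i0 w : 0 <= \1_A w :> R by rewrite indicE.
rewrite integral_mixture// (@nneseriesD1 _ _ n)//; last first.
  by move=> k _; rewrite lee_fin mulr_ge0 ?slot_weight_ge0// mean_ge0.
apply: lt_le_trans (leeDl _ _).
  rewrite lte_fin mulr_gt0 ?slot_weight_gt0//.
  by apply: (mean_gt0 (pT n) _ bs) => //=; rewrite indicE mem_set.
apply: nneseries_ge0 => k _ _.
by rewrite lee_fin mulr_ge0 ?slot_weight_ge0// mean_ge0.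
Qed.

(** On each interval [m, m + 1) [history] is constant, which gives right-continuity. A null set
    contains no branch, as branches have positive mass, so it satisfies the defining condition of
    [history] vacuously. *)
Lemma history_usual_conditions : usual_conditions (mixture pT) history.
Proof.
split; first exact: history_filtration.
- move=> t t0; apply/seteqP; split=> [A At u /= tu|A At].
    apply: history_trunc At; apply: le_truncn.
    by move: tu; rewrite in_itv/= andbT => /ltW.
  have /andP[t1 t2] := truncn_itv t0; move: t2; rewrite -natr1 => t2.
  pose u := (t + ((Num.trunc t)%:R + 1)) / 2.
  have uE : Num.trunc u = Num.trunc t.
    by apply: truncn_def; rewrite -(natr1 (Num.trunc t)) /u; apply/andP; split; lra.
  have tu : t < u by rewrite /u; lra.
  have : history u A by apply: At; rewrite /= in_itv/= tu.
  by apply: history_trunc; rewrite uE.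
move=> A [N [mN N0 AN]] n s s' bs _ _ As.
by have := mixture_gt0 bs (AN _ As); rewrite N0 ltxx.
Qed.

Definition initial_condexp (Y : runs -> R) (w : runs) : \bar R :=
  (mean (tr w.1) (fun s => Y (w.1, s)))%:E.

(** At time 0 only the number of the tree is known, so averaging over its coins is a version of the
    conditional expectation. *)
Lemma is_condexp_initial (Y : runs -> R) : (forall w, 0 <= Y w) ->
  is_condexp (mixture pT) (history 0) (EFin \o Y) (initial_condexp Y).
Proof.
move=> Y0; have m0 n : 0 <= mean (tr n) (fun s => Y (n, s)) by exact: mean_ge0.
split=> [w||A A0]; first by rewrite lee_fin.
  exact: measurable_wrt_history.
rewrite integral_mkcond [RHS]integral_mkcond.
pose f (Z : runs -> R) w := if w \in A then Z w else 0.
have fE (Z : runs -> R) : (EFin \o Z) \_ A = (fun w => (f Z w)%:E).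
  by apply/funext => w; rewrite patchE /f; case: ifP.
rewrite (fE (fun w => mean (tr w.1) (fun s => Y (w.1, s)))) fE.
rewrite !integral_mixture//; last 2 first.
- by move=> w; rewrite /f; case: ifP.
- by move=> w; rewrite /f; case: ifP.
apply: eq_eseriesr => n _; congr (_ * _)%:E.
(* A time-0 event contains either all branches of the [n]-th tree or none of them. *)
have [[s bs As]|/forall2NP nA] :=
    pselect (exists2 s, is_branch (tr n) s & A (n, s)).
  have inA s' : is_branch (tr n) s' -> (n, s') \in A.
    by move=> bs'; rewrite inE; apply: A0 As => //; rewrite truncn0 !take0.
  rewrite (@eq_mean _ _ _ (fun=> mean (tr n) (fun s => Y (n, s)))).
    by rewrite mean_cst; apply: eq_mean => s' /inA; rewrite /f => ->.
  by move=> s' /inA; rewrite /f => ->.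
apply: eq_mean => s bs.
have nAs : ((n, s) \in A) = false by apply/negbTE/negP; rewrite inE => As; case: (nA s).
by rewrite /f nAs.
Qed.

Section Processes.
Variables (n : nat) (lam : R).
Hypotheses (lam01 : 0 <= lam <= 1) (sn : snell 0 (tr n) <= 0).

(** Letting the processes live only while the [n]-th tree is played multiplies both moments by the
    same weight, which cancels in their ratio. *)
Definition slot_level t w : R :=
  if w.1 == n then lam * level 0 (tr n) w.2 t else 0.

Definition slot_charge t w : R :=
  if w.1 == n then charge (tr n) w.2 t else 0.

Let lam0 : 0 <= lam. Proof. by case/andP: lam01. Qed.

Lemma slot_level_continuous w : continuous (slot_level ^~ w).
Proof.
move=> t; rewrite /slot_level; case: (w.1 == n); last exact: cvg_cst.
by apply: cvgM; [exact: cvg_cst|exact: level_continuous].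
Qed.

Lemma slot_charge_continuous w : continuous (slot_charge ^~ w).
Proof.
move=> t; rewrite /slot_charge; case: (w.1 == n); last exact: cvg_cst.
exact: charge_continuous.
Qed.

Lemma slot_level_ge0 t w : 0 <= slot_level t w.
Proof.
rewrite /slot_level; case: ifP => // _; rewrite mulr_ge0//.
exact: level_ge0.
Qed.

Lemma slot_charge_ge0 t w : 0 <= slot_charge t w.
Proof. by rewrite /slot_charge; case: ifP => // _; exact: charge_ge0. Qed.

Lemma slot_level_adapted : adapted history slot_level.
Proof.
move=> t t0; have /andP[_ tt] := truncn_itv t0.
apply: measurable_wrt_history => m s s' _ _ ss'.
by rewrite /slot_level /= (level_take _ _ tt ss').
Qed.

Lemma slot_charge_adapted : adapted history slot_charge.
Proof.
move=> t t0; have /andP[_ tt] := truncn_itv t0.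
apply: measurable_wrt_history => m s s' _ _ ss'.
by rewrite /slot_charge /= (charge_take _ tt ss').
Qed.

Lemma slot_charge_predictable : predictable history slot_charge.
Proof.
move=> A mA; apply: sub_sigma_algebra; exists slot_charge => //; split.
  exact: slot_charge_adapted.
move=> w t _; apply: cvg_at_left_filter; exact: slot_charge_continuous.
Qed.

(** The stopping time property is applied at the deterministic time [tau (n, s)]. *)
Lemma stopping_rule_branch tau : bounded_stopping_time history tau ->
  stopping_rule (tr n) (fun s => tau (n, s)).
Proof.
case=> tau0 taut _; split=> // s s' bs bs' ss'.
exact: (taut _ (tau0 (n, s)) n s s' bs bs' ss' (lexx _)).
Qed.

(** On the [n]-th tree, domination follows from its Snell value being at most 0, and scaling the
    level by [lam <= 1] preserves it. On the other trees both sides are 0. *)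
Lemma slot_lenglart_domination :
  lenglart_domination (mixture pT) history slot_level slot_charge.
Proof.
split.
- by move=> t w _; split; [exact: slot_level_ge0|exact: slot_charge_ge0].
- by split; [exact: slot_level_adapted|exact: slot_charge_adapted].
- split=> w t _; apply: cvg_at_right_filter.
    exact: slot_level_continuous.
  exact: slot_charge_continuous.
- move=> w u t _ ut; rewrite /slot_charge; case: ifP => // _.
  exact: charge_nondecreasing.
- exact: slot_charge_predictable.
move=> tau st.
exists (initial_condexp (fun w => slot_level (tau w) w)).
exists (initial_condexp (fun w => slot_charge (tau w) w)); split.
- by apply: is_condexp_initial => w; exact: slot_level_ge0.
- by apply: is_condexp_initial => w; exact: slot_charge_ge0.
apply: aeW => -[m s0]; rewrite lee_fin /slot_level /slot_charge /=.
case: eqP => [->|_]; last by rewrite !mean_cst.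
have := stopped_le_snell 0 (pT n) (stopping_rule_branch st) => /le_trans/(_ sn).
under [X in mean _ X]eq_fun do rewrite -mulN1r.
rewrite meanD !meanZ mulN1r subr_le0; apply: le_trans.
rewrite ler_piMl//; last by case/andP: lam01.
by apply: mean_ge0 => // s _; exact: level_ge0.
Qed.

Lemma process_sup_slot_level w :
  process_sup slot_level w = (if w.1 == n then lam * peak 0 (tr n) w.2 else 0)%:E.
Proof.
apply: process_sup_attained => [t t0|]; rewrite /slot_level; case: ifP => // _.
- by rewrite ler_wpM2l// level_le_peak.
- by have [t t0 tE] := peak_attained 0 (tr n) w.2; exists t; rewrite ?tE.
- by exists 0.
Qed.

Lemma process_sup_slot_charge w :
  process_sup slot_charge w = (if w.1 == n then final_charge (tr n) w.2 else 0)%:E.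
Proof.
apply: process_sup_attained => [t t0|]; rewrite /slot_charge; case: ifP => // _.
- exact: charge_le_final_charge.
- by have [t t0 tE] := final_charge_attained (tr n) w.2; exists t.
- by exists 0.
Qed.

Lemma integral_slot (f : seq bool -> R) : (forall s, 0 <= f s) ->
  (\int[mixture pT]_w (if w.1 == n then f w.2 else 0)%:E =
   (slot_weight n * mean (tr n) f)%:E)%E.
Proof.
move=> f0; rewrite integral_mixture//; last by move=> w; case: ifP.
rewrite (@nneseriesD1 _ _ n)//=; last first.
  move=> k _; rewrite lee_fin mulr_ge0 ?slot_weight_ge0//.
  by apply: mean_ge0 => // s _; case: ifP.
rewrite eqxx eseries0 ?adde0// => k _ /negPf kn.
by rewrite kn mean_cst mulr0.
Qed.

Lemma integral_slot_level p : 0 < p ->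
  (\int[mixture pT]_w process_sup_pow slot_level p w =
   (slot_weight n * (lam `^ p * mean (tr n) (fun s => peak 0 (tr n) s `^ p)))%:E)%E.
Proof.
move=> p0; rewrite -meanZ -integral_slot.
  apply: eq_integral => w _.
  rewrite /process_sup_pow process_sup_slot_level poweR_EFin; congr _%:E.
  case: ifP => _; last by rewrite powR0// gt_eqF.
  by rewrite powRM// peak_ge.
by move=> s; rewrite mulr_ge0 ?powR_ge0.
Qed.

Lemma integral_slot_charge p : 0 < p ->
  (\int[mixture pT]_w process_sup_pow slot_charge p w =
   (slot_weight n * mean (tr n) (fun s => final_charge (tr n) s `^ p))%:E)%E.
Proof.
move=> p0; rewrite -integral_slot; last by move=> s; exact: powR_ge0.
apply: eq_integral => w _.
rewrite /process_sup_pow process_sup_slot_charge poweR_EFin; congr _%:E.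
by case: ifP => _ //; rewrite powR0// gt_eqF.
Qed.

End Processes.

End History.

(** * Sharpness of the constant *)

(** The conditional inequality is integrated over the whole space. Passing to the positive part of
    [c] only weakens it and lets the constant leave the integral. *)
Lemma lenglart_inequality_integral {R : realType} (p c : R)
  (d : measure_display) (Omega : measurableType d) (P : probability Omega R)
  (F : R -> set_system Omega) (X G : R -> Omega -> R) :
  lenglart_inequality p c -> usual_conditions P F ->
  lenglart_domination P F X G ->
  (\int[P]_w process_sup_pow X p w <=
   (Num.max 0 c)%:E * \int[P]_w process_sup_pow G p w)%E.
Proof.
move=> ineq uc dom; have [ZX [ZG [cX cG le]]] := ineq _ _ _ _ _ _ uc dom.
case: uc => -[sF mF _] _ _.
have F0T : F 0 setT.
  by have [F00 FD _] := sF 0 (lexx _); rewrite -(setD0 setT); exact: FD.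
have mZ Z : measurable_wrt setT (F 0) Z -> measurable_fun setT (Z : Omega -> \bar R).
  by move=> mZ _ B mB; apply: (mF 0) => //; apply: mZ; exists B.
have mZX := mZ _ (condexp_measurable cX).
have mZG := mZ _ (condexp_measurable cG).
rewrite -(condexp_integral cX F0T) -(condexp_integral cG F0T).
have c0 : (0 <= (Num.max 0 c)%:E)%E by rewrite lee_fin le_max lexx.
rewrite -ge0_integralZl//; last by move=> w _; exact: condexp_ge0 cG w.
apply: ae_ge0_le_integral => //.
- by move=> w _; exact: condexp_ge0 cX w.
- by move=> w _; apply: mule_ge0 => //; exact: condexp_ge0 cG w.
- exact: measurable_funeM.
apply: filterS le => w le _; apply: (le_trans le).
by rewrite lee_wpmul2r// ?lee_fin ?le_max ?lexx ?orbT//; exact: condexp_ge0 cG w.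
Qed.

(** Prescribing the ratios exactly serves both claims: ratios increasing to the constant give the
    limit, a constant sequence of ratios refutes any smaller constant. *)
Lemma sharp_family {R : realType} (p : R) (c : nat -> R) : 0 < p < 1 ->
  (forall n, 0 < c n < lenglart_const p) ->
  exists (P : probability runs R) (F : R -> set_system runs)
    (X G : nat -> R -> runs -> R),
  [/\ usual_conditions P F,
      (forall n, continuous_process (X n) /\ continuous_process (G n)),
      (forall n, lenglart_domination P F (X n) (G n)),
      (forall n, 0 < \int[P]_w process_sup_pow (G n) p w < +oo)%E &
      (forall n, (\int[P]_w process_sup_pow (X n) p w) /
        (\int[P]_w process_sup_pow (G n) p w) = (c n)%:E)%E].
Proof.
move=> /[dup] p01 /andP[p0 p1] c01.
have /choice[tr trP] n : exists T : tree R,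
  [/\ proper_tree T, snell 0 T <= 0,
      0 < mean T (fun s => final_charge T s `^ p) &
      c n * mean T (fun s => final_charge T s `^ p) <=
      mean T (fun s => peak 0 T s `^ p)].
  by apply: extremal_tree => //; have /andP[/ltW -> ->] := c01 n.
have pT n : proper_tree (tr n) by have [] := trP n.
have sn n : snell 0 (tr n) <= 0 by have [] := trP n.
pose a n := mean (tr n) (fun s => final_charge (tr n) s `^ p).
pose b n := mean (tr n) (fun s => peak 0 (tr n) s `^ p).
have a0 n : 0 < a n by have [] := trP n.
have ab n : c n * a n <= b n by have [] := trP n.
have c0 n : 0 < c n by have /andP[] := c01 n.
have b0 n : 0 < b n by apply: lt_le_trans (ab n); rewrite mulr_gt0.
(* The factor which brings the ratio of the moments down to [c n]. *)
pose lam n := (c n * a n / b n) `^ p^-1.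
have lamp n : lam n `^ p * b n = c n * a n.
  rewrite /lam -powRrM mulVf ?gt_eqF// powRr1 ?divfK ?gt_eqF//.
  by rewrite divr_ge0 ?mulr_ge0 ?ltW.
have lam01 n : 0 <= lam n <= 1.
  have e1 : 1 `^ p^-1 = 1 :> R by rewrite powR1.
  rewrite powR_ge0 /= -[leRHS]e1; apply: ge0_ler_powR; rewrite ?nnegrE//.
  - by rewrite invr_ge0 ltW.
  - by rewrite divr_ge0 ?mulr_ge0 ?ltW.
  - by rewrite ler_pdivrMr// mul1r.
exists (mixture pT), (history tr).
exists (fun n => slot_level tr n (lam n)), (slot_charge tr); split.
- exact: history_usual_conditions.
- move=> n; split=> w; apply: continuous_subspaceT => t.
    exact: slot_level_continuous.
  exact: slot_charge_continuous.
- by move=> n; exact: slot_lenglart_domination (lam01 n) (sn n).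
- move=> n; rewrite integral_slot_charge// lte_fin ltry andbT.
  by rewrite mulr_gt0 ?slot_weight_gt0//; exact: a0.
move=> n; rewrite integral_slot_charge// integral_slot_level//.
have w0 := slot_weight_gt0 (R := R) n.
rewrite -/(a n) -/(b n) lamp inver gt_eqF ?mulr_gt0// -EFinM.
by congr _%:E; field; rewrite !gt_eqF.
Qed.

Theorem theorem2p1 (R : realType) (p : R) (hp : 0 < p < 1) :
  (exists (d : measure_display) (Omega : measurableType d)
      (P : probability Omega R) (F : R -> set_system Omega)
      (X G : nat -> R -> Omega -> R),
    [/\ usual_conditions P F,
        (forall n, continuous_process (X n) /\ continuous_process (G n)),
        (forall n, lenglart_domination P F (X n) (G n)),
        (forall n, 0 < \int[P]_w process_sup_pow (G n) p w < +oo)%E &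
        ((\int[P]_w process_sup_pow (X n) p w) /
         (\int[P]_w process_sup_pow (G n) p w))%E
          @[n --> \oo] --> (lenglart_const p)%:E])
  /\ (forall c : R, c < lenglart_const p -> ~ lenglart_inequality p c).
Proof.
have L0 : 0 < lenglart_const p.
  by case/andP: hp => p0 p1; rewrite divr_gt0 ?powR_gt0 ?subr_gt0.
split=> [|c cL ineq].
  (* Halving keeps [c n] positive at [n = 0], where the harmonic term is 1. *)
  pose c n := lenglart_const p * (1 - harmonic n / 2).
  have h0 n : 0 < (harmonic n : R) <= 1.
    by rewrite /= invr_gt0 ltr0n/= invf_le1 ?ltr0n// ler1n.
  have c01 n : 0 < c n < lenglart_const p.
    by have := h0 n => h; rewrite /c pmulr_rgt0// gtr_pMr//; lra.
  have [P [F [X [G [uc cont dom G0 ratio]]]]] := sharp_family hp c01.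
  exists default_measure_display, runs, P, F, X, G; split=> //.
  under eq_fun do rewrite ratio.
  apply: cvg_EFin; first exact: nearW.
  have h2 : harmonic n / 2 @[n --> \oo] --> (0 / 2 : R).
    by apply: cvgM; [exact: cvg_harmonic|exact: cvg_cst].
  have cL : c n @[n --> \oo] --> lenglart_const p * (1 - 0 / 2).
    by apply: cvgM; [exact: cvg_cst|apply: cvgB => //; exact: cvg_cst].
  by rewrite mul0r subr0 mulr1 in cL.
(* A ratio strictly between the positive part of [c] and the sharp constant contradicts the
   integrated inequality. *)
pose e := (Num.max 0 c + lenglart_const p) / 2.
have mL : Num.max 0 c < lenglart_const p by rewrite gt_max L0.
have m0 : 0 <= Num.max 0 c by rewrite le_max lexx.
have me : Num.max 0 c < e by rewrite /e; lra.
have e01 (n : nat) : 0 < e < lenglart_const p.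
  by rewrite /e; apply/andP; split; lra.
have [P [F [X [G [uc _ dom G0 ratio]]]]] := sharp_family hp e01.
have := lenglart_inequality_integral ineq uc (dom 0%N).
have := G0 0%N; have := ratio 0%N.
case: (\int[P]_w process_sup_pow (G 0%N) p w)%E => [g| |]; rewrite ?ltxx ?andbF//.
rewrite ltry andbT lte_fin => + g0.
rewrite inver gt_eqF// => /eqP; rewrite eq_le => /andP[_ + le].
move=> /le_trans-/(_ ((Num.max 0 c)%:E)); rewrite lee_pdivrMr// => /(_ le).
by rewrite lee_fin leNgt me.
Qed.
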